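(* The set $\left\{\dfrac{zf'(z)}{f(z)}: z\in\mathbb D,\ f\in\mathcal C\right\}$ is equal to $\mathbb C\setminus\{0\}$.
   Context: $\mathbb D=\{z\in\mathbb C:|z|<1\}$. An analytic function $g$ on $\mathbb D$ with $g(0)=g'(0)-1=0$ is called convex if it is univalent and $g(\mathbb D)$ is a convex set. $\mathcal C$ denotes the class of close-to-convex functions, that is, analytic functions $f$ on $\mathbb D$ with $f(0)=f'(0)-1=0$ such that $\operatorname{Re}[e^{i\lambda}f'(z)/g'(z)]>0$ for all $z\in\mathbb D$, for some convex function $g$ (normalized by $g(0)=g'(0)-1=0$) and some real constant $\lambda$ with $|\lambda|<\pi/2$. Every $f\in\mathcal C$ is univalent, so $zf'(z)/f(z)$ is analytic and non-vanishing on $\mathbb D$, with value $1$ at $z=0$. *)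

(* Defs.v *)
From Stdlib Require Import Reals.
From Coquelicot Require Import Coquelicot.

Open Scope R_scope.

(* Functions on the unit disc are total functions C -> C of which only the
   values on the disc matter; sets of complex numbers are predicates. *)
Definition unit_disc (z : C) : Prop := Cmod z < 1.

(* Analytic means complex differentiable at every point of the open disc: the
   derivative is taken over the field C. *)
Definition analytic_on_disc (f : C -> C) : Prop :=
  forall z : C, unit_disc z -> ex_derive (K := C_AbsRing) (V := C_NormedModule) f z.

(* [C_derive f z] is the complex derivative wherever [f] is complex
   differentiable ([C_derive_correct]). *)
Definition normalized (f : C -> C) : Prop :=
  f 0%C = 0%C /\ C_derive f 0%C = 1%C.

Definition univalent (f : C -> C) : Prop :=
  forall z1 z2 : C, unit_disc z1 -> unit_disc z2 -> f z1 = f z2 -> z1 = z2.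

Definition image_of_disc (f : C -> C) (w : C) : Prop :=
  exists z : C, unit_disc z /\ f z = w.

Definition convex_set (S : C -> Prop) : Prop :=
  forall (a b : C) (t : R), S a -> S b -> 0 <= t <= 1 ->
    S (RtoC (1 - t) * a + RtoC t * b)%C.

Definition convex_function (g : C -> C) : Prop :=
  analytic_on_disc g /\ normalized g /\ univalent g /\
  convex_set (image_of_disc g).

Definition expi (t : R) : C := (cos t, sin t).

(* The quotient f'/g' is always a genuine one: where g' = 0, Coquelicot's
   division gives 0, whose real part is not positive (and, g being univalent,
   g' has no zero anyway). *)
Definition close_to_convex (f : C -> C) : Prop :=
  analytic_on_disc f /\ normalized f /\
  exists (g : C -> C) (lambda : R),
    convex_function g /\ Rabs lambda < PI / 2 /\
    forall z : C, unit_disc z ->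
      0 < Re (expi lambda * (C_derive f z / C_derive g z))%C.

(* The function z f'(z) / f(z), with its removable singularity at 0 filled in by
   the value 1. A zero of f other than 0 would produce the value 0, so no
   univalence of f is built into this definition. *)
Definition zderiv_quotient (f : C -> C) (z : C) : C :=
  if Ceq_dec z 0%C then 1%C else (z * C_derive f z / f z)%C.

(* Main.v *)
(* Nonvanishing: a close-to-convex [f] is univalent, because [f o g^-1] has a
   derivative [f' / g'] in an open half-plane on the convex domain [g(D)]; hence
   [f] vanishes only at [0], and [f'] vanishes nowhere. The differentiability of
   [g^-1] comes from an elementary open mapping argument.

   Surjectivity: for [|x|, |y| < 1] the function
     f = g + (y - x) g^2 / 2,  g(z) = z / (1 - y z),  f'(z) = (1 - x z) / (1 - y z)^3,
   is close-to-convex with respect to [g]. With [1 - x z = 1 / a] and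
   [1 - y z = 1 / b], where [a] and [b] range over the half-plane [Re > 1/2],
   [z f'(z) / f(z) = 2 b^2 / (a + b)], which equals a given [w <> 0] as soon as
   [a = 2 b^2 / w - b]; it remains to take [b] large in a direction such that
   [Re b > 0] and [Re (b^2 / w) > 0]. *)

Require Import Defs.
From Stdlib Require Import Reals.
From Coquelicot Require Import Coquelicot.
From Stdlib Require Import Lra Classical ClassicalEpsilon.

(** * Complex differentiability as an epsilon-delta estimate *)

Lemma is_C_derive_iff (f : C -> C) (z l : C) :
  is_derive (K := C_AbsRing) (V := C_NormedModule) f z l <->
  (forall eps, 0 < eps -> exists delta, 0 < delta /\
    forall u : C, Cmod (u - z) < delta ->
      Cmod (f u - f z - l * (u - z)) <= eps * Cmod (u - z)).
Proof.
split.
- intros [_ H] eps Heps.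
  destruct (H z (fun P HP => HP) (mkposreal eps Heps)) as [d Hd].
  exists d; split; [apply cond_pos|intros u Hu].
  replace (f u - f z - l * (u - z))%C
    with (f u - f z - (u - z) * l)%C by ring.
  exact (Hd u Hu).
- intros H; split; [apply is_linear_scal_l|].
  intros x Hx eps.
  (* The definition quantifies over every limit [x] of the neighbourhood filter of [z]; uniqueness
     of limits leaves only [z]. *)
  rewrite <- (is_filter_lim_locally_unique (V := AbsRing_NormedModule C_AbsRing) z x Hx).
  destruct (H eps (cond_pos eps)) as [d [Hd Hu]].
  exists (mkposreal d Hd); intros u Hb.
  change (Cmod (f u - f z - (u - z) * l) <= eps * Cmod (u - z)).
  replace (f u - f z - (u - z) * l)%C
    with (f u - f z - l * (u - z))%C by ring.
  exact (Hu u Hb).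
Qed.

Lemma Cmod_sub_sym (u v : C) : Cmod (u - v) = Cmod (v - u).
Proof. rewrite <- Cmod_opp; f_equal; ring. Qed.

Lemma Cmod_triangle_sub (u v w : C) : Cmod (u - w) <= Cmod (u - v) + Cmod (v - w).
Proof.
replace (u - w)%C with ((u - v) + (v - w))%C by ring; apply Cmod_triangle.
Qed.

Lemma Cmod_le_coords (z : C) : Cmod z <= Rabs (fst z) + Rabs (snd z).
Proof.
destruct z as [x y]; simpl.
replace (x, y) with (RtoC x + RtoC y * Ci)%C
  by (unfold RtoC, Ci, Cplus, Cmult; simpl; f_equal; ring).
eapply Rle_trans; [apply Cmod_triangle|].
rewrite Cmod_mult, Cmod_Ci, !Cmod_R; lra.
Qed.

Lemma coords_le_Cmod (z : C) : Rabs (fst z) <= Cmod z /\ Rabs (snd z) <= Cmod z.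
Proof.
pose proof (Rmax_Cmod z); split; (eapply Rle_trans; [|exact H]).
- apply Rmax_l.
- apply Rmax_r.
Qed.

Lemma is_C_derive_continuous (f : C -> C) (z l : C) :
  is_derive (K := C_AbsRing) (V := C_NormedModule) f z l ->
  forall eps, 0 < eps -> exists delta, 0 < delta /\
    forall u : C, Cmod (u - z) < delta -> Cmod (f u - f z) < eps.
Proof.
intros H eps Heps.
destruct (proj1 (is_C_derive_iff f z l) H 1 Rlt_0_1) as [d [Hd Hu]].
pose proof (Cmod_ge_0 l) as Hl.
exists (Rmin d (eps / (2 + Cmod l))); split.
- apply Rmin_pos; [lra|apply Rdiv_lt_0_compat; lra].
- intros u Hlt.
  pose proof (Rmin_l d (eps / (2 + Cmod l))).
  pose proof (Rmin_r d (eps / (2 + Cmod l))).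
  specialize (Hu u ltac:(lra)).
  replace (f u - f z)%C with ((f u - f z - l * (u - z)) + l * (u - z))%C by ring.
  eapply Rle_lt_trans; [apply Cmod_triangle|].
  rewrite Cmod_mult.
  pose proof (Cmod_ge_0 (u - z)).
  assert (Cmod (u - z) * (2 + Cmod l) < eps).
  { apply Rmult_lt_reg_r with (/ (2 + Cmod l)); [apply Rinv_0_lt_compat; lra|].
    rewrite Rmult_assoc, Rinv_r, Rmult_1_r by lra. fold (eps / (2 + Cmod l)); lra. }
  nra.
Qed.

(** * Compactness, open mapping and the derivative along an inverse *)

(** If the infimum [- m] were not attained, [F] would exceed it near each point by a positive gauge,
    and compactness of the rectangle would turn the gauges into one uniform gap [d], contradicting
    that [m] is the least upper bound of [- F]. *)
Lemma rectangle_min (F : C -> R) (a b a' b' : R) :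
  a <= b -> a' <= b' -> (forall p, 0 <= F p) ->
  (forall p, a <= fst p <= b -> a' <= snd p <= b' ->
    forall eps, 0 < eps -> exists delta, 0 < delta /\
      forall q : C, Rabs (fst q - fst p) < delta -> Rabs (snd q - snd p) < delta ->
        Rabs (F q - F p) < eps) ->
  exists p : C, (a <= fst p <= b /\ a' <= snd p <= b') /\
    forall q : C, a <= fst q <= b -> a' <= snd q <= b' -> F p <= F q.
Proof.
intros Hab Hab' Hpos Hcont.
set (E := fun r => exists p : C, a <= fst p <= b /\ a' <= snd p <= b' /\ r = - F p).
destruct (completeness E) as [m [Hub Hlub]].
- exists 0; intros r [p [_ [_ ->]]]; specialize (Hpos p); lra.
- exists (- F (a, a')); exists (a, a'); simpl; lra.
- apply NNPP; intros Hno.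
  assert (Hgt : forall p : C, a <= fst p <= b -> a' <= snd p <= b' -> - m < F p).
  { intros p Hp Hp'; destruct (Rlt_or_le (- m) (F p)) as [H|H]; [exact H|].
    exfalso; apply Hno; exists p; split; [tauto|]; intros q Hq Hq'.
    assert (- F q <= m) by (apply Hub; exists q; tauto); lra. }
  (* The same [d] is the radius of the neighbourhood and the gap above [- m], so a single gauge
     carries both. *)
  assert (Hd : forall u v : R, exists d : posreal,
     a <= u <= b -> a' <= v <= b' -> forall q : C,
       Rabs (fst q - u) < d -> Rabs (snd q - v) < d -> - m + d < F q).
  { intros u v.
    destruct (classic (a <= u <= b /\ a' <= v <= b')) as [[Hu Hv]|Hn];
      [|exists (mkposreal 1 Rlt_0_1); tauto].
    specialize (Hgt (u, v) Hu Hv).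
    destruct (Hcont (u, v) Hu Hv ((F (u, v) + m) / 2) ltac:(lra)) as [d [Hd Hq]].
    assert (Hd' : 0 < Rmin d ((F (u, v) + m) / 2)) by (apply Rmin_pos; lra).
    exists (mkposreal _ Hd'); simpl; intros _ _ q Hq1 Hq2.
    pose proof (Rmin_l d ((F (u, v) + m) / 2)).
    pose proof (Rmin_r d ((F (u, v) + m) / 2)).
    specialize (Hq q ltac:(simpl; lra) ltac:(simpl; lra)).
    apply Rabs_def2 in Hq; lra. }
  set (delta := fun u v => proj1_sig (constructive_indefinite_description _ (Hd u v))).
  destruct (compactness_value_2d a b a' b' delta) as [d Hcov].
  assert (m <= m - d); [|pose proof (cond_pos d); lra].
  apply Hlub; intros r [p [Hp [Hp' ->]]].
  apply NNPP; intros Hlt.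
  apply (Hcov (fst p) (snd p) Hp Hp'); intros [u [v [Hu [Hv [H1 [H2 H3]]]]]].
  unfold delta in H1, H2, H3.
  destruct (constructive_indefinite_description _ (Hd u v)) as [e He]; simpl in *.
  specialize (He Hu Hv p H1 H2); lra.
Qed.

(* Minimise [|g - w|] over a small square around [z0]. Since [dg z0 <> 0], the
   minimum is not on the boundary when [w] is close to [g z0]; at an interior
   minimum [p], moving from [p] in the direction [(w - g p) / dg p] would
   decrease [|g - w|] unless [g p = w]. Continuity of [dg] is not used. *)
Lemma local_surjection (g dg : C -> C) (z0 : C) (r : R) :
  0 < r ->
  (forall z : C, Cmod (z - z0) < r ->
     is_derive (K := C_AbsRing) (V := C_NormedModule) g z (dg z) /\ dg z <> 0%C) ->
  exists rho, 0 < rho /\ forall w : C, Cmod (w - g z0) < rho ->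
    exists z : C, Cmod (z - z0) < r /\ g z = w.
Proof.
intros Hr Hg.
assert (H00 : Cmod (z0 - z0) < r).
{ replace (z0 - z0)%C with (RtoC 0) by ring; rewrite Cmod_0; lra. }
destruct (Hg z0 H00) as [Hd0 Hn0].
apply Cmod_gt_0 in Hn0; set (m := Cmod (dg z0)) in *.
destruct (proj1 (is_C_derive_iff _ _ _) Hd0 (m / 2) ltac:(lra)) as [d [Hd Hlin]].
set (s := Rmin r d / 3).
assert (Hs : 0 < s) by (unfold s; pose proof (Rmin_pos r d Hr Hd); lra).
assert (Hsr : 2 * s < r /\ 2 * s < d)
  by (unfold s in *; pose proof (Rmin_l r d); pose proof (Rmin_r r d); lra).
assert (Hbox : forall p : C, fst z0 - s <= fst p <= fst z0 + s ->
   snd z0 - s <= snd p <= snd z0 + s -> Cmod (p - z0) <= 2 * s).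
{ intros p H1 H2; eapply Rle_trans; [apply Cmod_le_coords|]; simpl.
  assert (Rabs (fst p + - fst z0) <= s) by (apply Rabs_le; lra).
  assert (Rabs (snd p + - snd z0) <= s) by (apply Rabs_le; lra). lra. }
(* With this radius a minimiser [p] has |g p - g z0| < m s / 2, while linearisation at [z0] gives |g
   p - g z0| >= (m/2) |p - z0|; hence |p - z0| < s and [p] is interior. *)
exists (m * s / 4); split; [nra|]; intros w Hw.
destruct (rectangle_min (fun z => Cmod (g z - w)) (fst z0 - s) (fst z0 + s)
   (snd z0 - s) (snd z0 + s)) as [p [[Hp1 Hp2] Hmin]]; try lra.
- intros; apply Cmod_ge_0.
- intros p H1 H2 eps Heps.
  assert (Hp : Cmod (p - z0) < r) by (pose proof (Hbox p H1 H2); lra).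
  destruct (is_C_derive_continuous _ _ _ (proj1 (Hg p Hp)) eps Heps) as [e [He Hc]].
  exists (e / 2); split; [lra|]; intros q Hq1 Hq2.
  assert (Hq : Cmod (q - p) < e).
  { eapply Rle_lt_trans; [apply Cmod_le_coords|]; simpl in *.
    unfold Rminus in *; lra. }
  specialize (Hc q Hq).
  pose proof (Cmod_triangle_sub (g q) (g p) w).
  pose proof (Cmod_triangle_sub (g p) (g q) w).
  rewrite (Cmod_sub_sym (g p) (g q)) in H0.
  apply Rabs_def1; lra.
- assert (Hp : Cmod (p - z0) <= 2 * s) by (apply Hbox; assumption).
  exists p; split; [lra|].
  assert (Hz0 : Cmod (g p - w) <= Cmod (g z0 - w)) by (apply Hmin; lra).
  rewrite (Cmod_sub_sym (g z0)) in Hz0.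
  assert (Hin : Cmod (p - z0) < s).
  { specialize (Hlin p ltac:(lra)).
    pose proof (Cmod_triangle_sub (g p) w (g z0)).
    assert (m * Cmod (p - z0) <= Cmod (g p - g z0) + m / 2 * Cmod (p - z0)).
    { unfold m at 1; rewrite <- Cmod_mult.
      replace (dg z0 * (p - z0))%C
        with ((g p - g z0) + - (g p - g z0 - dg z0 * (p - z0)))%C by ring.
      eapply Rle_trans; [apply Cmod_triangle|]; rewrite Cmod_opp; lra. }
    nra. }
  apply NNPP; intros Hne.
  destruct (Hg p ltac:(lra)) as [Hdp Hnp].
  pose proof (proj1 (Cmod_gt_0 _) Hnp) as Hmp.
  assert (Hh : (w - g p)%C <> 0%C).
  { intros E; apply Hne; replace w with (g p + (w - g p))%C by ring; rewrite E; ring. }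
  apply Cmod_gt_0 in Hh.
  destruct (proj1 (is_C_derive_iff _ _ _) Hdp (Cmod (dg p) / 2) ltac:(lra))
    as [e [He Hlp]].
  set (v := ((w - g p) / dg p)%C).
  assert (Hv : Cmod v * Cmod (dg p) = Cmod (w - g p)).
  { rewrite <- Cmod_mult; f_equal; unfold v; field; exact Hnp. }
  assert (Hv0 : 0 < Cmod v) by (pose proof (Cmod_ge_0 v); nra).
  set (e' := Rmin e (s - Cmod (p - z0))).
  assert (He' : 0 < e' /\ e' <= e /\ e' <= s - Cmod (p - z0)).
  { unfold e'; repeat split; [apply Rmin_pos; lra|apply Rmin_l|apply Rmin_r]. }
  set (t := Rmin 1 (e' / (2 * Cmod v))).
  assert (Ht : 0 < t /\ t <= 1 /\ t * Cmod v < e').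
  { assert (0 < e' / (2 * Cmod v)) by (apply Rdiv_lt_0_compat; lra).
    unfold t; repeat split; [apply Rmin_pos; lra|apply Rmin_l|].
    apply Rle_lt_trans with (e' / (2 * Cmod v) * Cmod v);
      [apply Rmult_le_compat_r; [lra|apply Rmin_r]|].
    replace (e' / (2 * Cmod v) * Cmod v) with (e' / 2) by (field; lra); lra. }
  set (q := (p + t * v)%C).
  assert (Hqp : Cmod (q - p) = t * Cmod v).
  { replace (q - p)%C with (RtoC t * v)%C by (unfold q; ring).
    rewrite Cmod_mult, Cmod_R, Rabs_pos_eq by lra; reflexivity. }
  assert (Hqz : Cmod (q - z0) < s)
    by (pose proof (Cmod_triangle_sub q p z0); lra).
  assert (Cmod (g p - w) <= Cmod (g q - w)).
  { destruct (coords_le_Cmod (q - z0)) as [Hq1 Hq2].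
    apply Hmin; apply Rabs_le_between'.
    - exact (Rle_trans _ _ _ Hq1 (Rlt_le _ _ Hqz)).
    - exact (Rle_trans _ _ _ Hq2 (Rlt_le _ _ Hqz)). }
  specialize (Hlp q ltac:(lra)).
  assert (Hq : (g q - w)%C =
    ((g q - g p - dg p * (q - p)) + - (RtoC (1 - t) * (w - g p)))%C).
  { unfold q, v; rewrite RtoC_minus; field; exact Hnp. }
  (* Since |v| |dg p| = |w - g p|, this bound equals (1 - t/2) |w - g p|, strictly below the
     minimum. *)
  assert (Cmod (g q - w) <= Cmod (dg p) / 2 * (t * Cmod v) + (1 - t) * Cmod (w - g p)).
  { rewrite Hq; eapply Rle_trans; [apply Cmod_triangle|].
    rewrite Cmod_opp, Cmod_mult, Cmod_R, Rabs_pos_eq by lra.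
    rewrite Hqp in Hlp; lra. }
  rewrite (Cmod_sub_sym (g p) w) in H. nra.
Qed.

(** As w - w0 = g (k w) - g (k w0), the remainder at [w] is that of [f] minus [lf / lg] times that
    of [g], both taken at [k w]. Since [lg] is nonzero, |k w - k w0| is at most a constant times |w
    - w0|. *)
Lemma is_C_derive_comp_inverse (f g k : C -> C) (w0 lf lg : C) :
  is_derive (K := C_AbsRing) (V := C_NormedModule) f (k w0) lf ->
  is_derive (K := C_AbsRing) (V := C_NormedModule) g (k w0) lg ->
  lg <> 0%C -> g (k w0) = w0 ->
  (forall r, 0 < r -> exists rho, 0 < rho /\ forall w : C,
     Cmod (w - w0) < rho -> Cmod (k w - k w0) < r /\ g (k w) = w) ->
  is_derive (K := C_AbsRing) (V := C_NormedModule) (fun w => f (k w)) w0 (lf / lg)%C.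
Proof.
intros Hf Hg Hlg Hw0 Hk; apply is_C_derive_iff; intros eps Heps.
set (M := Cmod (lf / lg)); pose proof (Cmod_ge_0 (lf / lg) : 0 <= M) as HM.
set (m := Cmod lg); pose proof (proj1 (Cmod_gt_0 _) Hlg : 0 < m) as Hm.
(* The first bound absorbs the remainder of [g], giving (m/2) x <= |w - w0|; the second then keeps
   the total error e (1 + M) x below eps |w - w0|. *)
set (e := Rmin (m / 2) (eps * m / (2 * (1 + M)))).
assert (He : 0 < e /\ e <= m / 2 /\ e * (1 + M) <= eps * m / 2).
{ assert (0 < eps * m / (2 * (1 + M))) by (apply Rdiv_lt_0_compat; nra).
  unfold e; repeat split; [apply Rmin_pos; lra|apply Rmin_l|].
  apply Rle_trans with (eps * m / (2 * (1 + M)) * (1 + M));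
    [apply Rmult_le_compat_r; [lra|apply Rmin_r]|].
  apply Req_le; field; lra. }
destruct (proj1 (is_C_derive_iff _ _ _) Hf e ltac:(lra)) as [d1 [Hd1 H1]].
destruct (proj1 (is_C_derive_iff _ _ _) Hg e ltac:(lra)) as [d2 [Hd2 H2]].
destruct (Hk (Rmin d1 d2) (Rmin_pos _ _ Hd1 Hd2)) as [rho [Hrho Hw]].
exists rho; split; [exact Hrho|]; intros w Hlt.
destruct (Hw w Hlt) as [Hkw Hgw].
pose proof (Rmin_l d1 d2); pose proof (Rmin_r d1 d2).
specialize (H1 (k w) ltac:(lra)); specialize (H2 (k w) ltac:(lra)).
rewrite Hgw, Hw0 in H2.
set (x := Cmod (k w - k w0)) in *.
pose proof (Cmod_ge_0 (k w - k w0) : 0 <= x).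
assert (Hx : m * x <= Cmod (w - w0) + e * x).
{ unfold m, x; rewrite <- Cmod_mult; fold x.
  replace (lg * (k w - k w0))%C
    with ((w - w0) + - (w - w0 - lg * (k w - k w0)))%C by ring.
  eapply Rle_trans; [apply Cmod_triangle|]; rewrite Cmod_opp; lra. }
replace (f (k w) - f (k w0) - lf / lg * (w - w0))%C
  with ((f (k w) - f (k w0) - lf * (k w - k w0))
        + - (lf / lg * (w - w0 - lg * (k w - k w0))))%C by (field; exact Hlg).
eapply Rle_trans; [apply Cmod_triangle|]; rewrite Cmod_opp, Cmod_mult; fold M.
assert (M * Cmod (w - w0 - lg * (k w - k w0)) <= M * (e * x))
  by (apply Rmult_le_compat_l; lra).
assert (m / 2 * x <= Cmod (w - w0)) by nra.
assert (e * (1 + M) * x <= eps * m / 2 * x) by (apply Rmult_le_compat_r; lra).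
assert (eps * (m / 2 * x) <= eps * Cmod (w - w0)) by (apply Rmult_le_compat_l; lra).
lra.
Qed.

(** * Univalence of close-to-convex functions *)

(** The mean value theorem fails for complex values; this real projection along a segment makes the
    real one applicable. *)
Lemma derivable_Re_along_line (F : C -> C) (a d mu l : C) (t : R) :
  is_derive (K := C_AbsRing) (V := C_NormedModule) F (a + t * d)%C l ->
  is_derive (fun s : R => Re (mu * F (a + s * d)%C)) t (Re (mu * (l * d))%C).
Proof.
intros H; apply is_derive_Reals; intros eps Heps.
pose proof (Cmod_ge_0 mu); pose proof (Cmod_ge_0 d).
set (K := Cmod mu * Cmod d + 1); assert (HK : 0 < K) by (unfold K; nra).
destruct (proj1 (is_C_derive_iff _ _ _) H (eps / (2 * K))
  ltac:(apply Rdiv_lt_0_compat; lra)) as [e [He Hlin]].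
assert (He' : 0 < e / (Cmod d + 1)) by (apply Rdiv_lt_0_compat; lra).
exists (mkposreal _ He'); intros h Hh0 Hh; cbv beta; cbn [pos] in Hh.
assert (Hd : (a + RtoC (t + h) * d - (a + t * d))%C = (RtoC h * d)%C)
  by (rewrite RtoC_plus; ring).
assert (Hm : Cmod (RtoC h * d) = Rabs h * Cmod d) by (rewrite Cmod_mult, Cmod_R; reflexivity).
pose proof (Rabs_pos_lt h Hh0).
specialize (Hlin (a + RtoC (t + h) * d)%C); rewrite Hd, Hm in Hlin.
assert (Hsmall : Rabs h * Cmod d < e).
{ assert (Rabs h * (Cmod d + 1) < e).
  { apply Rlt_le_trans with (e / (Cmod d + 1) * (Cmod d + 1));
      [apply Rmult_lt_compat_r; lra|apply Req_le; field; lra]. }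
  nra. }
specialize (Hlin Hsmall).
set (E := (F (a + RtoC (t + h) * d) - F (a + t * d) - l * (RtoC h * d))%C) in *.
assert (Eq : (Re (mu * F (a + RtoC (t + h) * d)%C) - Re (mu * F (a + t * d)%C)) / h
   - Re (mu * (l * d))%C = Re (mu * E)%C / h).
{ unfold E; generalize (F (a + RtoC (t + h) * d)%C) (F (a + t * d)%C).
  intros [x1 y1] [x2 y2]; destruct mu, l, d; simpl; field; exact Hh0. }
rewrite Eq; unfold Rdiv; rewrite Rabs_mult, Rabs_inv.
apply Rmult_lt_reg_r with (Rabs h); [lra|].
rewrite Rmult_assoc, Rinv_l, Rmult_1_r by lra.
eapply Rle_lt_trans; [apply re_le_Cmod|]; rewrite Cmod_mult.
apply Rle_lt_trans with (Cmod mu * (eps / (2 * K) * (Rabs h * Cmod d)));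
  [apply Rmult_le_compat_l; lra|].
replace (Cmod mu * (eps / (2 * K) * (Rabs h * Cmod d)))
  with (Rabs h * (eps / (2 * K) * (Cmod mu * Cmod d))) by ring.
rewrite (Rmult_comm eps); apply Rmult_lt_compat_l; [lra|].
apply Rle_lt_trans with (eps / (2 * K) * K).
- apply Rmult_le_compat_l; [apply Rlt_le, Rdiv_lt_0_compat; lra|unfold K; lra].
- replace (eps / (2 * K) * K) with (eps / 2) by (field; lra); lra.
Qed.

Lemma Cdiv_0_r (z : C) : (z / 0)%C = 0%C.
Proof.
destruct z as [x y]; unfold Cdiv, Cinv, Cmult, RtoC; simpl.
unfold Rdiv; f_equal; ring.
Qed.

Lemma Cdiv_0_l (z : C) : (0 / z)%C = 0%C.
Proof. unfold Cdiv; ring. Qed.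

(* The Noshiro-Warschawski argument: on the convex image of [g] the function
   [f o g^-1] has derivative [f' / g'], whose values lie in an open half-plane
   bounded by a line through [0]. *)
Lemma close_to_convex_univalent (f : C -> C) : close_to_convex f -> univalent f.
Proof.
intros [Hf [_ [g [lam [[Hg [_ [Hinj Hconv]]] [_ Hre]]]]]] z1 z2 Hz1 Hz2 Heq.
assert (Hg' : forall z, unit_disc z -> C_derive g z <> 0%C).
{ intros z Hz E; specialize (Hre z Hz); rewrite E, Cdiv_0_r, Cmult_0_r in Hre.
  simpl in Hre; lra. }
(* An inverse of [g] obtained by choice; off the image of [g] its values are arbitrary. *)
set (k := fun w => epsilon (inhabits (RtoC 0)) (fun z : C => unit_disc z /\ g z = w)).
assert (Hk : forall w, image_of_disc g w -> unit_disc (k w) /\ g (k w) = w)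
  by (intros w Hw; exact (epsilon_spec (inhabits (RtoC 0)) _ Hw)).
assert (Hkg : forall z, unit_disc z -> k (g z) = z).
{ intros z Hz; destruct (Hk (g z)) as [H1 H2]; [exists z; tauto|].
  apply Hinj; assumption. }
assert (HF : forall w, image_of_disc g w ->
  is_derive (K := C_AbsRing) (V := C_NormedModule) (fun w => f (k w)) w
    (C_derive f (k w) / C_derive g (k w))%C).
{ intros w Hw; destruct (Hk w Hw) as [Hd Hgk].
  apply is_C_derive_comp_inverse with g; try apply C_derive_correct; auto.
  intros r Hr.
  assert (Hr' : 0 < Rmin r (1 - Cmod (k w))) by (apply Rmin_pos; unfold unit_disc in Hd; lra).
  pose proof (Rmin_l r (1 - Cmod (k w))); pose proof (Rmin_r r (1 - Cmod (k w))).
  assert (Hball : forall z, Cmod (z - k w) < Rmin r (1 - Cmod (k w)) -> unit_disc z).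
  { intros z Hz; unfold unit_disc in *.
    replace z with ((z - k w) + k w)%C by ring.
    eapply Rle_lt_trans; [apply Cmod_triangle|]; lra. }
  (* Continuity of [k] at [w]: each nearby [w'] is [g z] with [z] close to [k w], and injectivity
     forces [z = k w']. *)
  destruct (local_surjection g (C_derive g) (k w) _ Hr') as [rho [Hrho Hs]].
  - intros z Hz; split; [apply C_derive_correct; auto|auto].
  - rewrite Hgk in Hs; exists rho; split; [exact Hrho|]; intros w' Hw'.
    destruct (Hs w' Hw') as [z [Hz <-]].
    rewrite Hkg by auto; split; [lra|reflexivity]. }
apply NNPP; intros Hne.
set (a := g z1); set (d := (g z2 - g z1)%C).
assert (Hd : d <> 0%C).
{ intros E; apply Hne, Hinj; auto; replace (g z2) with (g z1 + d)%C by (unfold d; ring).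
  rewrite E; ring. }
assert (Hseg : forall t, 0 <= t <= 1 -> image_of_disc g (a + t * d)%C).
{ intros t Ht; replace (a + t * d)%C with (RtoC (1 - t) * g z1 + RtoC t * g z2)%C
    by (unfold a, d; rewrite RtoC_minus; ring).
  apply Hconv; [exists z1; auto|exists z2; auto|exact Ht]. }
(* Dividing by [d] cancels the chain-rule factor along the segment, so the derivative is Re (e^(i
   lam) f'/g') > 0, whereas [f z1 = f z2] makes the total increment 0. *)
set (mu := (expi lam / d)%C).
set (w := fun t : R => (a + t * d)%C).
destruct (MVT_gen (fun t => Re (mu * f (k (w t)))%C) 0 1
  (fun t => Re (mu * (C_derive f (k (w t)) / C_derive g (k (w t)) * d))%C))
  as [c [Hc E]].
- intros t; rewrite Rmin_left, Rmax_right by lra; intros Ht.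
  apply (derivable_Re_along_line (fun w => f (k w))), HF, Hseg; lra.
- intros t; rewrite Rmin_left, Rmax_right by lra; intros Ht.
  apply derivable_continuous_pt; eexists; apply is_derive_Reals.
  apply (derivable_Re_along_line (fun w => f (k w))), HF, Hseg; lra.
- rewrite Rmin_left, Rmax_right in Hc by lra.
  assert (H0 : w 0 = g z1) by (unfold w, a; ring).
  assert (H1 : w 1 = g z2) by (unfold w, a, d; ring).
  rewrite H0, H1, !Hkg, Heq in E by assumption.
  destruct (Hk (w c) (Hseg c Hc)) as [Hin _].
  specialize (Hre _ Hin).
  replace (mu * (C_derive f (k (w c)) / C_derive g (k (w c)) * d))%C
    with (expi lam * (C_derive f (k (w c)) / C_derive g (k (w c))))%C in E
    by (unfold mu; field; split; [apply Hg', Hin|exact Hd]).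
  lra.
Qed.

Lemma zderiv_quotient_neq0 (f : C -> C) (z : C) :
  close_to_convex f -> unit_disc z -> zderiv_quotient f z <> 0%C.
Proof.
intros Hf Hz; unfold zderiv_quotient.
destruct (Ceq_dec z 0) as [->|Hz0]; [exact C1_nz|].
assert (Hfz : f z <> 0%C).
{ intros E; apply Hz0, (close_to_convex_univalent f Hf); auto.
  - unfold unit_disc; rewrite Cmod_0; lra.
  - destruct Hf as [_ [[H0 _] _]]; congruence. }
destruct Hf as [_ [_ [g [lam [_ [_ Hre]]]]]].
specialize (Hre z Hz).
assert (C_derive f z <> 0%C).
{ intros E; rewrite E, Cdiv_0_l, Cmult_0_r in Hre; simpl in Hre; lra. }
unfold Cdiv; repeat apply Cmult_neq_0; auto.
intros E; apply C1_nz; rewrite <- (Cinv_r (f z)), E by auto; ring.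
Qed.

(** * The two-parameter family and its derivatives *)

Definition disc_to_disc (y z : C) : C := (z / (1 - y * z))%C.

(** The coefficient is chosen so that, with g = [disc_to_disc y], f'/g' = 1 + (y - x) g = (1 - x z)
    / (1 - y z). *)
Definition ctc_example (x y z : C) : C :=
  (disc_to_disc y z + (y - x) / 2 * (disc_to_disc y z * disc_to_disc y z))%C.

Lemma one_minus_mult_lower_bound (y z : C) :
  unit_disc z -> 1 - Cmod y <= Cmod (1 - y * z).
Proof.
unfold unit_disc; intros Hz.
pose proof (Cmod_triangle (1 - y * z) (y * z)) as H.
replace (1 - y * z + y * z)%C with (RtoC 1) in H by ring.
rewrite Cmod_1, Cmod_mult in H.
pose proof (Cmod_ge_0 y); nra.
Qed.

Lemma one_minus_mult_neq0 (y z : C) :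
  Cmod y < 1 -> unit_disc z -> (1 - y * z)%C <> 0%C.
Proof.
intros Hy Hz; apply Cmod_gt_0.
pose proof (one_minus_mult_lower_bound y z Hz); lra.
Qed.

Lemma is_C_derive_disc_to_disc (y a : C) : Cmod y < 1 -> unit_disc a ->
  is_derive (K := C_AbsRing) (V := C_NormedModule) (disc_to_disc y) a
    (/ ((1 - y * a) * (1 - y * a)))%C.
Proof.
intros Hy Ha; apply is_C_derive_iff; intros eps Heps.
set (k := 1 - Cmod y); assert (Hk : 0 < k) by (unfold k; lra).
assert (Hk3 : 0 < k * k * k) by (repeat apply Rmult_lt_0_compat; lra).
(* The first bound keeps [u] in the disc. The remainder is y (u - a)^2 / ((1 - y a)^2 (1 - y u)),
   whose denominator has modulus at least k^3. *)
exists (Rmin (1 - Cmod a) (eps * (k * k * k))); split.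
{ apply Rmin_pos; unfold unit_disc in Ha; nra. }
intros u Hu.
pose proof (Rmin_l (1 - Cmod a) (eps * (k * k * k))).
pose proof (Rmin_r (1 - Cmod a) (eps * (k * k * k))).
assert (Hud : unit_disc u).
{ unfold unit_disc; replace u with ((u - a) + a)%C by ring.
  eapply Rle_lt_trans; [apply Cmod_triangle|]; lra. }
pose proof (one_minus_mult_neq0 y u Hy Hud) as Hnu.
pose proof (one_minus_mult_neq0 y a Hy Ha) as Hna.
pose proof (one_minus_mult_lower_bound y u Hud) as Hbu.
pose proof (one_minus_mult_lower_bound y a Ha) as Hba.
fold k in Hbu, Hba.
replace (disc_to_disc y u - disc_to_disc y a - / ((1 - y * a) * (1 - y * a)) * (u - a))%C
  with (y * (u - a) * (u - a) / ((1 - y * a) * (1 - y * a) * (1 - y * u)))%C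
  by (unfold disc_to_disc; field; auto).
rewrite Cmod_div by (repeat apply Cmult_neq_0; assumption).
rewrite !Cmod_mult.
set (D := Cmod (1 - y * a) * Cmod (1 - y * a) * Cmod (1 - y * u)).
assert (HD : k * k * k <= D) by (unfold D; repeat apply Rmult_le_compat; nra).
apply Rmult_le_reg_r with D; [lra|].
replace (Cmod y * Cmod (u - a) * Cmod (u - a) / D * D)
  with (Cmod (u - a) * (Cmod y * Cmod (u - a))) by (field; lra).
rewrite (Rmult_comm eps), Rmult_assoc.
pose proof (Cmod_ge_0 (u - a)); pose proof (Cmod_ge_0 y).
apply Rmult_le_compat_l; nra.
Qed.

(* The two normed-module structures on [C] have the same norm but different
   uniform structures, so Coquelicot's product rule does not apply directly. *)
Lemma is_C_derive_AbsRing (f : C -> C) (z l : C) :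
  is_derive (K := C_AbsRing) (V := C_NormedModule) f z l <->
  is_derive (K := C_AbsRing) (V := AbsRing_NormedModule C_AbsRing) f z l.
Proof. split; intros [_ H]; (split; [apply is_linear_scal_l|exact H]). Qed.

Lemma is_C_derive_ctc_example (x y a : C) : Cmod y < 1 -> unit_disc a ->
  is_derive (K := C_AbsRing) (V := C_NormedModule) (ctc_example x y) a
    ((1 - x * a) / ((1 - y * a) * ((1 - y * a) * (1 - y * a))))%C.
Proof.
intros Hy Ha.
pose proof (proj1 (is_C_derive_AbsRing _ _ _) (is_C_derive_disc_to_disc y a Hy Ha)) as Hg.
pose proof (one_minus_mult_neq0 y a Hy Ha) as Hna.
apply is_C_derive_AbsRing.
pose proof (is_derive_mult (K := C_AbsRing) _ _ a _ _ Hg Hg Cmult_comm) as Hm.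
pose proof (is_derive_mult (K := C_AbsRing) _ _ a _ _
  (is_derive_const (K := C_AbsRing) (V := AbsRing_NormedModule C_AbsRing) ((y - x) / 2)%C a)
  Hm Cmult_comm) as Hs.
pose proof (is_derive_plus (K := C_AbsRing) (V := AbsRing_NormedModule C_AbsRing)
  _ _ a _ _ Hg Hs) as Hp.
match type of Hp with is_derive _ _ ?l => replace ((1 - x * a) / _)%C with l end.
- exact Hp.
- unfold plus, mult, zero, one, disc_to_disc; simpl.
  change (/ ((1 - y * a) * (1 - y * a)) +
  (0 * (a / (1 - y * a) * (a / (1 - y * a))) +
   (y - x) / 2 * (/ ((1 - y * a) * (1 - y * a)) * (a / (1 - y * a)) +
     a / (1 - y * a) * / ((1 - y * a) * (1 - y * a)))) =
   (1 - x * a) / ((1 - y * a) * ((1 - y * a) * (1 - y * a))))%C.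
  field; exact Hna.
Qed.

(** * Convexity of the comparison function *)

Lemma Cmod_lt_iff_sqr (u v : C) : Cmod u < Cmod v <-> Cmod u ^ 2 < Cmod v ^ 2.
Proof.
pose proof (Cmod_ge_0 u); pose proof (Cmod_ge_0 v); split; intros; nra.
Qed.

(** The inverse map is w / (1 + y w), and the inequality says that this preimage lies in the unit
    disc. *)
Lemma image_disc_to_disc (y w : C) : Cmod y < 1 ->
  image_of_disc (disc_to_disc y) w <-> Cmod w < Cmod (1 + y * w).
Proof.
intros Hy; split.
- intros [z [Hz <-]].
  pose proof (one_minus_mult_neq0 y z Hy Hz) as Hn.
  replace (1 + y * disc_to_disc y z)%C with (1 / (1 - y * z))%C
    by (unfold disc_to_disc; field; exact Hn).
  unfold disc_to_disc; rewrite !Cmod_div, Cmod_1 by exact Hn.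
  apply Rmult_lt_compat_r; [apply Rinv_0_lt_compat, Cmod_gt_0, Hn|exact Hz].
- intros H; pose proof (Cmod_ge_0 w).
  assert (Hn : (1 + y * w)%C <> 0%C) by (apply Cmod_gt_0; lra).
  exists (w / (1 + y * w))%C; split.
  + unfold unit_disc; rewrite Cmod_div by exact Hn.
    apply Rmult_lt_reg_r with (Cmod (1 + y * w)); [lra|].
    unfold Rdiv; rewrite Rmult_assoc, Rinv_l; lra.
  + unfold disc_to_disc; field; split; [exact Hn|].
    replace (1 + y * w - y * w)%C with (RtoC 1) by ring; exact C1_nz.
Qed.

Lemma convex_disc_to_disc (y : C) : Cmod y < 1 -> convex_function (disc_to_disc y).
Proof.
intros Hy; assert (H0 : unit_disc 0%C) by (unfold unit_disc; rewrite Cmod_0; lra).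
repeat split.
- intros z Hz; eexists; apply is_C_derive_disc_to_disc; assumption.
- unfold disc_to_disc, Cdiv; ring.
- rewrite (is_C_derive_unique _ _ _ (is_C_derive_disc_to_disc y 0%C Hy H0)).
  field.
- intros z1 z2 Hz1 Hz2 E.
  pose proof (one_minus_mult_neq0 y z1 Hy Hz1).
  pose proof (one_minus_mult_neq0 y z2 Hy Hz2).
  (* The difference of the two values is (z1 - z2) / ((1 - y z1) (1 - y z2)). *)
  replace z1 with (z2 + (disc_to_disc y z1 - disc_to_disc y z2)
    * ((1 - y * z1) * (1 - y * z2)))%C by (unfold disc_to_disc; field; auto).
  rewrite E; ring.
- intros a b t Ha Hb Ht.
  apply image_disc_to_disc in Ha, Hb; try exact Hy; apply image_disc_to_disc; [exact Hy|].
  apply Cmod_lt_iff_sqr in Ha, Hb; apply Cmod_lt_iff_sqr.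
  set (w := (RtoC (1 - t) * a + RtoC t * b)%C).
  (* The function |w|^2 - |1 + y w|^2 has quadratic part (1 - |y|^2) |w|^2, hence is convex; the
     last term is the exact convexity defect. *)
  assert (Id : Cmod w ^ 2 - Cmod (1 + y * w) ^ 2 =
    (1 - t) * (Cmod a ^ 2 - Cmod (1 + y * a) ^ 2) + t * (Cmod b ^ 2 - Cmod (1 + y * b) ^ 2)
    - t * (1 - t) * (1 - Cmod y ^ 2) * Cmod (a - b) ^ 2).
  { unfold w; rewrite !Cmod2_alt; destruct a, b, y; simpl; ring. }
  assert (0 <= t * (1 - t) * (1 - Cmod y ^ 2) * Cmod (a - b) ^ 2).
  { pose proof (Cmod_ge_0 y).
    apply Rmult_le_pos; [apply Rmult_le_pos; nra|apply pow2_ge_0]. }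
  enough ((1 - t) * (Cmod a ^ 2 - Cmod (1 + y * a) ^ 2)
    + t * (Cmod b ^ 2 - Cmod (1 + y * b) ^ 2) < 0) by lra.
  (* One of the two weights is at least 1/2, which gives strict negativity. *)
  destruct (Rle_lt_dec t (1 / 2)); nra.
Qed.

(** * The half-plane condition for f'/g' *)

Lemma pseudo_hyperbolic_identity (u v : C) :
  Cmod (1 - u * Cconj v) ^ 2 - Cmod (u - v) ^ 2
  = (1 - Cmod u ^ 2) * (1 - Cmod v ^ 2).
Proof. rewrite !Cmod2_alt; destruct u, v; simpl; ring. Qed.

Lemma pseudo_hyperbolic_lt (u v : C) : Cmod u < 1 -> Cmod v < 1 ->
  Cmod (u - v) < Cmod (1 - u * Cconj v).
Proof.
intros Hu Hv; apply Cmod_lt_iff_sqr; pose proof (pseudo_hyperbolic_identity u v).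
pose proof (Cmod_ge_0 u); pose proof (Cmod_ge_0 v).
assert (0 < (1 - Cmod u ^ 2) * (1 - Cmod v ^ 2)) by (apply Rmult_lt_0_compat; nra).
lra.
Qed.

(** In the right half-plane the argument of [c] is the arctangent of Im c / Re c; the scale [s] is
    1/|c|. *)
Lemma expi_direction (c : C) : 0 < Re c ->
  exists lam s, Rabs lam < PI / 2 /\ 0 < s /\ expi lam = (RtoC s * c)%C.
Proof.
destruct c as [p q]; simpl; intros Hp.
destruct (atan_bound (q / p)) as [H1 H2].
assert (Hc : 0 < cos (atan (q / p))) by (apply cos_gt_0; lra).
exists (atan (q / p)), (cos (atan (q / p)) / p); repeat split.
- apply Rabs_def1; lra.
- apply Rdiv_lt_0_compat; lra.
- unfold expi, Cmult, RtoC; simpl.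
  pose proof (tan_atan (q / p)) as Ht; unfold tan in Ht.
  f_equal; [field; lra|].
  replace (sin (atan (q / p))) with (sin (atan (q / p)) / cos (atan (q / p))
    * cos (atan (q / p))) by (field; lra).
  rewrite Ht; field; lra.
Qed.

(** Expanding the square, the hypothesis reads |A|^2 < 2 Re (A conj B). *)
Lemma Re_pos_of_dist_lt (A B : C) : Cmod (A - B) < Cmod B -> 0 < Re (A * Cconj B)%C.
Proof.
intros H; apply Cmod_lt_iff_sqr in H; rewrite !Cmod2_alt in H.
destruct A, B; simpl in *; nra.
Qed.

(* [z |-> (1 - x z) / (1 - y z)] maps the unit disc onto the disc of centre
   [(1 - x conj y) / (1 - |y|^2)] and radius [|x - y| / (1 - |y|^2)], which does not
   contain [0]. *)
Lemma Re_moebius_pos (x y z : C) : Cmod x < 1 -> Cmod y < 1 -> unit_disc z ->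
  0 < Re ((1 - Cconj x * y) * ((1 - x * z) / (1 - y * z)))%C.
Proof.
intros Hx Hy Hz; pose proof (one_minus_mult_neq0 y z Hy Hz) as Hn.
set (N := 1 - Cmod y ^ 2).
assert (HN : 0 < N) by (unfold N; pose proof (Cmod_ge_0 y); nra).
(* [A / B] is the Moebius quotient divided by the centre of its image disc. The factorisation of
   [A - B] reduces |A - B| < |B| to two pseudo-hyperbolic inequalities. *)
set (A := (RtoC N * (1 - x * z))%C).
set (B := ((1 - x * Cconj y) * (1 - y * z))%C).
assert (HAB : (A - B)%C = ((x - y) * (Cconj y - z))%C).
{ unfold A, B, N; rewrite RtoC_minus, Cmod2_conj; ring. }
assert (H : 0 < Re (A * Cconj B)%C).
{ apply Re_pos_of_dist_lt; rewrite HAB; unfold B; rewrite !Cmod_mult.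
  apply Rmult_le_0_lt_compat; try apply Cmod_ge_0.
  - apply pseudo_hyperbolic_lt; assumption.
  - rewrite Cmod_sub_sym, Cmult_comm.
    rewrite <- (Cconj_conj y) at 2; apply pseudo_hyperbolic_lt; [exact Hz|].
    rewrite Cmod_conj; exact Hy. }
pose proof (proj1 (Cmod_gt_0 _) Hn) as Hm.
assert (HNm : 0 < N * Cmod (1 - y * z) ^ 2) by (apply Rmult_lt_0_compat; [lra|apply pow_lt, Hm]).
replace ((1 - Cconj x * y) * ((1 - x * z) / (1 - y * z)))%C
  with (RtoC (/ (N * Cmod (1 - y * z) ^ 2)) * (A * Cconj B))%C.
- rewrite re_scal_l; apply Rmult_lt_0_compat; [apply Rinv_0_lt_compat, HNm|exact H].
- rewrite RtoC_inv, RtoC_mult, Cmod2_conj by lra.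
  unfold A, B; rewrite Cmult_conj.
  replace (Cconj (1 - x * Cconj y)) with (1 - Cconj x * y)%C
    by (destruct x, y; unfold Cconj, Cminus, Cplus, Copp, Cmult, RtoC; simpl; f_equal; ring).
  assert (Cconj (1 - y * z) <> 0%C) by (apply Cmod_gt_0; rewrite Cmod_conj; exact Hm).
  assert (RtoC N <> 0%C) by (intros E; apply RtoC_inj in E; lra).
  field; auto.
Qed.

Lemma ctc_example_close_to_convex (x y : C) :
  Cmod x < 1 -> Cmod y < 1 -> close_to_convex (ctc_example x y).
Proof.
intros Hx Hy; assert (H0 : unit_disc 0%C) by (unfold unit_disc; rewrite Cmod_0; lra).
split; [|split; [split|]].
- intros z Hz; eexists; apply is_C_derive_ctc_example; assumption.
- unfold ctc_example, disc_to_disc, Cdiv; ring.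
- rewrite (is_C_derive_unique _ _ _ (is_C_derive_ctc_example x y 0%C Hy H0)); field.
(* This [lam] is minus the argument of the centre of the disc of values of f'/g', so the rotation
   moves that centre onto the positive axis. *)
- destruct (expi_direction (1 - Cconj x * y)%C) as [lam [s [Hlam [Hs E]]]].
  { pose proof (re_le_Cmod (Cconj x * y)%C) as H; rewrite Cmod_mult, Cmod_conj in H.
    pose proof (Rle_abs (Re (Cconj x * y)%C)).
    pose proof (Cmod_ge_0 x); pose proof (Cmod_ge_0 y).
    change (0 < 1 + - Re (Cconj x * y)%C); nra. }
  exists (disc_to_disc y), lam; split; [apply convex_disc_to_disc, Hy|split; [exact Hlam|]].
  intros z Hz.
  pose proof (one_minus_mult_neq0 y z Hy Hz) as Hn.
  rewrite (is_C_derive_unique _ _ _ (is_C_derive_ctc_example x y z Hy Hz)).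
  rewrite (is_C_derive_unique _ _ _ (is_C_derive_disc_to_disc y z Hy Hz)).
  replace (expi lam * _)%C
    with (RtoC s * ((1 - Cconj x * y) * ((1 - x * z) / (1 - y * z))))%C
    by (rewrite E; field; exact Hn).
  rewrite re_scal_l; apply Rmult_lt_0_compat; [exact Hs|].
  apply Re_moebius_pos; assumption.
Qed.

(** * Attaining every nonzero value *)

(** For z nonzero the quotient depends only on the products u = x z and v = y z; a real [z] with
    max(|u|, |v|) < z < 1 realises both. *)
Lemma zderiv_quotient_ctc_example (u v : C) : Cmod u < 1 -> Cmod v < 1 ->
  exists (x y z : C), (Cmod x < 1 /\ Cmod y < 1 /\ unit_disc z) /\
    zderiv_quotient (ctc_example x y) z
    = ((1 - u) / ((1 - v) * (1 - (u + v) / 2)))%C.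
Proof.
intros Hu Hv; pose proof (Cmod_ge_0 u); pose proof (Cmod_ge_0 v).
set (M := Rmax (Cmod u) (Cmod v)); set (r := (M + 1) / 2).
assert (HM : Cmod u <= M /\ Cmod v <= M /\ M < 1).
{ unfold M; repeat split; [apply Rmax_l|apply Rmax_r|apply Rmax_lub_lt; assumption]. }
assert (Hr : M < r < 1 /\ 0 < r) by (unfold r; lra).
assert (Hr0 : RtoC r <> 0%C) by (intros E; apply RtoC_inj in E; lra).
assert (Hdiv : forall q : C, Cmod q <= M -> Cmod (q / r) < 1).
{ intros q Hq; rewrite Cmod_div, Cmod_R, Rabs_pos_eq by (auto; lra).
  apply Rmult_lt_reg_r with r; [lra|].
  unfold Rdiv; rewrite Rmult_assoc, Rinv_l; lra. }
assert (Hz : unit_disc r) by (unfold unit_disc; rewrite Cmod_R, Rabs_pos_eq; lra).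
assert (Hy : Cmod (v / r) < 1) by (apply Hdiv; lra).
exists (u / r)%C, (v / r)%C, (RtoC r); split; [repeat split; auto; apply Hdiv; lra|].
unfold zderiv_quotient; destruct (Ceq_dec r 0) as [E|_]; [contradiction|].
rewrite (is_C_derive_unique _ _ _ (is_C_derive_ctc_example (u / r) (v / r) r Hy Hz)).
unfold ctc_example, disc_to_disc.
assert (Eur : (u / r * r)%C = u) by (field; exact Hr0).
assert (Evr : (v / r * r)%C = v) by (field; exact Hr0).
assert (Hv1 : (1 - v)%C <> 0%C) by (rewrite <- Evr; apply one_minus_mult_neq0; assumption).
rewrite Eur, Evr.
assert (Huv : (2 - (u + v))%C <> 0%C).
{ intros E; pose proof (Cmod_triangle u v) as Ht.
  replace (u + v)%C with (2 - (2 - (u + v)))%C in Ht by ring; rewrite E in Ht.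
  replace (2 - 0)%C with (RtoC 2) in Ht by ring.
  rewrite Cmod_R, Rabs_pos_eq in Ht; lra. }
field; repeat split; auto.
replace (r * (2 * (1 - v)) + (v - u) * r)%C with (r * (2 - (u + v)))%C by ring.
apply Cmult_neq_0; assumption.
Qed.

(** Equivalently |b - 1| < |b|: [b] is closer to 1 than to 0. *)
Lemma Cmod_one_minus_inv_lt (b : C) : 1 / 2 < Re b -> b <> 0%C -> Cmod (1 - / b) < 1.
Proof.
intros Hb Hn; pose proof (proj1 (Cmod_gt_0 _) Hn).
replace (1 - / b)%C with ((b - 1) / b)%C by (field; exact Hn).
rewrite Cmod_div by exact Hn.
apply Rmult_lt_reg_r with (Cmod b); [lra|].
unfold Rdiv; rewrite Rmult_assoc, Rinv_l, Rmult_1_r, Rmult_1_l by lra.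
apply Cmod_lt_iff_sqr; rewrite !Cmod2_alt; destruct b; simpl in *; nra.
Qed.

(** Squares of right half-plane points omit only the closed negative axis, so some b^2 can turn [m]
    into the right half-plane. *)
Lemma Re_sqr_mult_pos (m : C) : m <> 0%C ->
  exists b : C, 0 < Re b /\ 0 < Re (b * b * m)%C.
Proof.
destruct m as [c d]; intros Hm.
destruct (Rlt_le_dec 0 c) as [Hc|Hc]; [exists 1%C; simpl; lra|].
destruct (Req_dec d 0) as [->|Hd].
- assert (c <> 0) by (intros ->; apply Hm; reflexivity).
  exists (1, 2); simpl; nra.
(* For b = 1 - i k d the real part is c - (k d)^2 c + 2 k d^2; this [k] makes it 2 - c - (k d)^2 c,
   positive because c <= 0. *)
- set (k := (1 - c) / (d * d)); assert (Hk : k * (d * d) = 1 - c) by (unfold k; field; auto).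
  exists (1, - (k * d)); simpl; split; [lra|].
  assert (0 <= (k * d) * (k * d)) by nra.
  replace ((1 * 1 - - (k * d) * - (k * d)) * c - (1 * - (k * d) + - (k * d) * 1) * d)
    with (c - (k * d) * (k * d) * c + 2 * (k * (d * d))) by ring.
  nra.
Qed.

Lemma half_planes_cover (w : C) : w <> 0%C ->
  exists a b : C, 1 / 2 < Re a /\ 1 / 2 < Re b /\ (w * (a + b))%C = (2 * (b * b))%C.
Proof.
intros Hw.
destruct (Re_sqr_mult_pos (/ w)%C) as [b [Hb Hm]].
{ intros E; apply C1_nz; rewrite <- (Cinv_r w Hw), E; ring. }
set (p := Re b) in *; set (q := Re (b * b * / w)%C) in *.
(* The term 1/p ensures T p > 1, and p/q + 1/q ensures T q > p + 1; then Re a = T (2 T q - p) >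
   1/2. *)
set (T := 1 / p + p / q + 1 / q + 1).
assert (H1 : 0 < 1 / p) by (apply Rdiv_lt_0_compat; lra).
assert (H2 : 0 < 1 / q) by (apply Rdiv_lt_0_compat; lra).
assert (H3 : 0 < p / q) by (apply Rdiv_lt_0_compat; lra).
exists (RtoC (2 * T ^ 2) * (b * b * / w) - RtoC T * b)%C, (RtoC T * b)%C.
assert (Hp : 1 / p * p = 1) by (field; lra).
assert (Hq : 1 / q * q = 1) by (field; lra).
assert (Hpq : p / q * q = p) by (field; lra).
assert (HTp : 1 < T * p) by (unfold T; nra).
assert (HTq : p + 1 < T * q) by (unfold T; nra).
assert (HT : 1 < T) by (unfold T; lra).
split; [|split].
- change (1 / 2 < Re (RtoC (2 * T ^ 2) * (b * b * / w))%C + - Re (RtoC T * b)%C).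
  rewrite !re_scal_l; fold p q. nra.
- rewrite re_scal_l; fold p; lra.
- replace (RtoC (2 * T ^ 2)) with (2 * (RtoC T * RtoC T))%C
    by (rewrite RtoC_mult; simpl; rewrite Rmult_1_r, RtoC_mult; reflexivity).
  field; exact Hw.
Qed.

Theorem corollary1p7 :
  forall w : C,
    (exists (f : C -> C) (z : C),
        close_to_convex f /\ unit_disc z /\ w = zderiv_quotient f z)
    <-> w <> 0%C.
Proof.
intros w; split.
- intros [f [z [Hf [Hz ->]]]]; exact (zderiv_quotient_neq0 f z Hf Hz).
- intros Hw.
  destruct (half_planes_cover w Hw) as [a [b [Ha [Hb E]]]].
  assert (Hne : forall c : C, 0 < Re c -> c <> 0%C)
    by (intros c Hc ->; simpl in Hc; lra).
  assert (Ha0 : a <> 0%C) by (apply Hne; lra).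
  assert (Hb0 : b <> 0%C) by (apply Hne; lra).
  assert (Hab : (a + b)%C <> 0%C) by (apply Hne; destruct a, b; simpl in *; lra).
  (* With 1 - u = 1/a and 1 - v = 1/b the value becomes 2 b^2 / (a + b). *)
  destruct (zderiv_quotient_ctc_example (1 - / a)%C (1 - / b)%C) as [x [y [z [[Hx [Hy Hz]] Q]]]].
  + apply Cmod_one_minus_inv_lt; assumption.
  + apply Cmod_one_minus_inv_lt; assumption.
  + exists (ctc_example x y), z; split; [|split].
    * apply ctc_example_close_to_convex; assumption.
    * exact Hz.
    * rewrite Q.
      replace w with (w * (a + b) / (a + b))%C by (field; exact Hab).
      rewrite E; field; repeat split; auto.
      -- replace (a * b * 2 - ((a - 1) * b + (b - 1) * a))%C with (a + b)%C by ring; exact Hab.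
      -- replace (b - (b - 1))%C with (RtoC 1) by ring; exact C1_nz.
Qed.
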